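(* Let $\mathcal X\subset\mathbb R$ be compact and for each $d\in\mathbb N$ let $q_d:\mathcal X\times\mathcal X\to\mathbb R$ be a continuous positive semi-definite kernel. Consider on $\mathcal X^{\otimes d}\subset\mathbb R^d$ the tensor product kernel $$k_d(x,x')=\prod_{j=1}^d q_d(x_{(j)},x'_{(j)}),$$ and let $\|\cdot\|_{\mathcal H_{k_d}}$ be the Hilbert norm of its reproducing kernel Hilbert space. Assume that there exists a probability measure $\mu$ on $\mathcal X$ with full support such that $\int q_d(x,x)\,d\mu(x)\le1$ for all $d$. Then for any $f$ that is a non-constant sparsely parameterized product function $f(x)=\prod_{j=1}^m f_j(x_{(j)})$ for some fixed $m\in\mathbb N$ (and fixed $f_1,\dots,f_m:\mathcal X\to\mathbb R$), $$\|f\|_{\mathcal H_{k_d}}\to\infty\quad\text{as } d\to\infty .$$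
   Context: $x_{(j)}$ denotes the $j$-th coordinate of $x\in\mathcal X^{\otimes d}$ ($\mathcal X^{\otimes d}$ is the $d$-fold product space). For $d\ge m$ the function $f$ is regarded as a function on $\mathcal X^{\otimes d}$ depending only on the first $m$ coordinates. By convention $\|f\|_{\mathcal H_{k_d}}=\infty$ if $f$ does not belong to the RKHS of $k_d$. *)

(* Defs.v *)
From HB Require Import structures.
From mathcomp Require Import all_boot all_order all_algebra.
From mathcomp Require Import all_classical all_reals all_analysis.

Set Implicit Arguments.
Unset Strict Implicit.
Unset Printing Implicit Defensive.

Import Order.TTheory GRing.Theory Num.Theory.
Import numFieldNormedType.Exports.

Local Open Scope classical_set_scope.
Local Open Scope ring_scope.

Definition psd_kernel (R : realType) (T : Type) (k : T -> T -> R) : Prop :=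
  (forall x y, k x y = k y x) /\
  (forall (n : nat) (x : 'I_n -> T) (a : 'I_n -> R),
     0 <= \sum_(i < n) \sum_(j < n) a i * a j * k (x i) (x j)).

(* A Hilbert space of functions on T is given as an abstract Hilbert space
   together with an injective linear map [rkhs_fun] to T -> R, which identifies
   its elements with functions; [rkhs_section x] is the function k(., x).
   By the Moore-Aronszajn theorem, a positive semi-definite k has exactly one
   such space, up to an isometry that commutes with [rkhs_fun]. *)
Record rkhs (R : realType) (T : Type) (k : T -> T -> R) := Rkhs {
  rkhs_space :> completeNormedModType R ;
  rkhs_dot : {dot rkhs_space for idfun} ;
  rkhs_fun : {linear rkhs_space -> (T -> R)} ;
  rkhs_section : T -> rkhs_space ;
  rkhs_dotE : forall h, rkhs_dot h h = `|h| ^+ 2 ;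
  rkhs_fun_inj : injective rkhs_fun ;
  rkhs_sectionE : forall x y, rkhs_fun (rkhs_section x) y = k y x ;
  rkhs_reproducing : forall h x, rkhs_fun h x = rkhs_dot h (rkhs_section x) }.

Arguments rkhs_dot {R T k} r.
Arguments rkhs_fun {R T k} r.
Arguments rkhs_section {R T k} r.

Definition rkhs_norm (R : realType) (T : Type) (k : T -> T -> R) (H : rkhs k)
    (f : T -> R) : \bar R :=
  if pselect (exists h : H, rkhs_fun H h = f) is left fH
  then `|projT1 (cid fH)|%:E else +oo%E.

Definition tensor_kernel (R : realType) (T : Type) (q : T -> T -> R) (d : nat)
    (x x' : 'I_d -> T) : R :=
  \prod_(j < d) q (x j) (x' j).

(* f seen as a function of the first m of d coordinates; this is meaningful
   only for m <= d, and the value 0 for d < m is a dummy. *)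
Definition cylinder (R : realType) (T : Type) (m : nat) (f : ('I_m -> T) -> R)
    (d : nat) : ('I_d -> T) -> R :=
  match @idP (m <= d)%N with
  | ReflectT le_md => fun x => f (fun i => x (widen_ord le_md i))
  | ReflectF _ => fun=> 0
  end.

(* The support of mu, a Borel measure on the line, is the whole of X (for X
   closed): mu is carried by X and charges every nonempty relatively open
   subset of X. *)
Definition full_support (R : realType) (X : set R)
    (mu : probability (measurableTypeR R) R) : Prop :=
  mu X = 1%E /\
  forall U : set R, open U -> U `&` X !=set0 -> (0 < mu (U `&` X))%E.

(* Main.v *)
Require Import Defs.
From HB Require Import structures.
From mathcomp Require Import all_boot all_order all_algebra.
From mathcomp Require Import all_classical all_reals all_analysis.
From mathcomp Require Import measurable_realfun.
From mathcomp Require Import ring lra.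

(** Why the norms blow up.  On the tensor product, the norm of f factors as the
    product of the norms of the f_j and of (d - m) copies of the norm of the
    constant 1 in the space of q_d.  The trace bound on q_d forces that last
    norm to be at least 1, so if the norms of f stayed bounded it would tend
    to 1.  Then q_d - a_d is still positive semi-definite for constants a_d
    tending to 1, and as the integral of q_d(x, x) is at most 1, that of
    q_d(x, x) - a_d tends to 0: the kernels q_d degenerate to the constant 1,
    and the norms of a fixed non-constant f_j in their spaces cannot remain
    bounded, whereas those of the other factors stay away from 0.

    The argument is run without constructing any tensor product of Hilbert
    spaces.  Only lower bounds on norms are needed, and these come from testing
    the function against products of measures supported by two points
    ([rkhs_pair_test]): by Cauchy-Schwarz, with nu the product of the nu_j,
      (prod_j nu_j(g_j))^2 <= |h|^2 * prod_j q(nu_j, nu_j)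
    when h represents the product of the g_j.  Three choices of the nu_j give
    the proof.
    - A difference of two Dirac masses in one coordinate bounds the variation
      of f_j by that of the kernel, at one fixed d: hence f_j is continuous
      ([factor_continuous]).
    - One measure delta_v + c delta_w repeated in the last d - m coordinates
      gives K (1 + c)^(2 (d - m)) <= const * q(nu, nu)^(d - m); taking
      (d - m)-th roots, q - (1 - eps) is nonnegative on such measures for d
      large ([rkhs_point_test], [expr_bound_ler]).
    - A difference of Dirac masses at points near u and near y_i0, where f_i0
      takes distinct values, then contradicts the smallness of q - (1 - eps)
      near these points ([rkhs_difference_test]).
    All the points have to be chosen, for each d separately, in neighbourhoods
    that do not depend on d and where q_d(x, x) is controlled: this is Markov's
    inequality, with constants independent of d because the measure of a
    neighbourhood is positive ([full_support_nbhs]). *)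

Set Implicit Arguments.
Unset Strict Implicit.
Unset Printing Implicit Defensive.

Import Order.TTheory GRing.Theory Num.Theory.
Import numFieldNormedType.Exports.

Local Open Scope classical_set_scope.
Local Open Scope ring_scope.

(** * Testing elements of a reproducing kernel Hilbert space *)

Lemma rkhs_dotC (R : realType) (T : Type) (k : T -> T -> R) (H : rkhs k)
    (u v : H) : rkhs_dot H u v = rkhs_dot H v u.
Proof. by rewrite hermC /= expr0 mul1r. Qed.

Lemma rkhs_cauchy_schwarz (R : realType) (T : Type) (k : T -> T -> R)
    (H : rkhs k) (u v : H) :
  rkhs_dot H u v ^+ 2 <= rkhs_dot H u u * rkhs_dot H v v.
Proof.
have [->|v0] := eqVneq v 0.
  by rewrite !linear0r expr0n.
have vv : 0 < rkhs_dot H v v by rewrite rkhs_dotE exprn_gt0 // normr_gt0.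
(* The vector n u - d v is n times the component of u orthogonal to v. *)
set d := rkhs_dot H u v; set n := rkhs_dot H v v.
have : 0 <= rkhs_dot H (n *: u - d *: v) (n *: u - d *: v).
  by rewrite rkhs_dotE sqr_ge0.
rewrite linearBl /= !linearBr /= !linearZl_LR /= !linearZr_LR /=.
rewrite (rkhs_dotC v u) -/d -/n.
set e := rkhs_dot H u u.
rewrite (_ : _ - _ = n * (e * n - d ^+ 2)); last first.
  by rewrite /GRing.scale /=; ring.
by rewrite pmulr_rge0 // subr_ge0.
Qed.

(** Pairing h with the representer of the measure sum_s c_s delta_(x_s), whose
    squared norm is the double sum on the right. *)
Lemma rkhs_finite_test (R : realType) (T : Type) (k : T -> T -> R)
    (H : rkhs k) (h : H) (S : finType) (c : S -> R) (x : S -> T) :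
  (\sum_s c s * rkhs_fun H h (x s)) ^+ 2 <=
  `|h| ^+ 2 * \sum_s \sum_t c s * c t * k (x s) (x t).
Proof.
set v : H := \sum_s c s *: rkhs_section H (x s).
have -> : \sum_s c s * rkhs_fun H h (x s) = rkhs_dot H h v.
  rewrite linear_sumr /=; apply: eq_bigr => s _.
  by rewrite linearZr_LR /= rkhs_reproducing.
have -> : \sum_s \sum_t c s * c t * k (x s) (x t) = rkhs_dot H v v.
  rewrite {1}/v linear_sumlz /=; apply: eq_bigr => s _.
  rewrite linear_sumr /=; apply: eq_bigr => t _.
  rewrite [RHS]linearZl_LR [X in _ = _ *: X]linearZr_LR /= rkhs_dotC.
  by rewrite -rkhs_reproducing rkhs_sectionE /GRing.scale /= mulrA.
by rewrite -rkhs_dotE rkhs_cauchy_schwarz.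
Qed.

(** The test measure is the product over j of sum_i w_j(i) delta_(x_j(i)); it is
    supported by the points indexed by {ffun 'I_d -> I}, and distributivity
    turns both its value on h and its squared norm into products over j. *)
Lemma rkhs_product_test (R : realType) (T : Type) (q : T -> T -> R) (d : nat)
    (H : rkhs (@tensor_kernel R T q d)) (h : H) (g : 'I_d -> T -> R)
    (I : finType) (w : 'I_d -> I -> R) (x : 'I_d -> I -> T) :
  (forall y, rkhs_fun H h y = \prod_(j < d) g j (y j)) ->
  (\prod_(j < d) \sum_i w j i * g j (x j i)) ^+ 2 <=
  `|h| ^+ 2 *
  \prod_(j < d) \sum_i \sum_l w j i * w j l * q (x j i) (x j l).
Proof.
move=> hE.
have := rkhs_finite_test h (fun s : {ffun 'I_d -> I} => \prod_j w j (s j))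
  (fun s j => x j (s j)).
under eq_bigr do rewrite hE -big_split /=.
rewrite -(bigA_distr_bigA (fun j i => w j i * g j (x j i))).
suff -> : forall F : 'I_d -> I -> I -> R,
    \prod_j \sum_i \sum_l F j i l =
    \sum_(s : {ffun 'I_d -> I}) \sum_(t : {ffun 'I_d -> I})
      \prod_j F j (s j) (t j).
  congr (_ <= _ * _); apply: eq_bigr => s _; apply: eq_bigr => t _.
  by rewrite /tensor_kernel !big_split.
move=> F; rewrite bigA_distr_bigA; apply: eq_bigr => s _.
by rewrite bigA_distr_bigA.
Qed.

(** The energy q(nu, nu) of the measure nu = delta_x + b delta_y. *)
Definition pair_form (R : realType) (T : Type) (q : T -> T -> R) (b : R)
  (x y : T) : R := q x x + 2 * b * q x y + b ^+ 2 * q y y.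

Lemma rkhs_pair_test (R : realType) (T : Type) (q : T -> T -> R) (d : nat)
    (H : rkhs (@tensor_kernel R T q d)) (h : H) (g : 'I_d -> T -> R)
    (b : 'I_d -> R) (x y : 'I_d -> T) :
  (forall u v, q u v = q v u) ->
  (forall z, rkhs_fun H h z = \prod_(j < d) g j (z j)) ->
  (\prod_(j < d) (g j (x j) + b j * g j (y j))) ^+ 2 <=
  `|h| ^+ 2 * \prod_(j < d) pair_form q (b j) (x j) (y j).
Proof.
move=> qC hE.
have := rkhs_product_test (fun j (i : bool) => if i then 1 else b j)
  (fun j (i : bool) => if i then x j else y j) hE.
congr (_ ^+ 2 <= _ * _); apply: eq_bigr => j _.
  by rewrite big_bool /= mul1r.
by rewrite !big_bool /= /pair_form (qC (y j) (x j)); ring.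
Qed.

(** Indexing the padded family by nat rather than by 'I_d avoids transporting
    along an equation d = m + (d - m). *)
Definition pad (m : nat) (A : Type) (a : 'I_m -> A) (a0 : A) (j : nat) : A :=
  oapp a a0 (insub j).

Lemma pad_lt (m : nat) (A : Type) (a : 'I_m -> A) (a0 : A) (i : 'I_m) :
  pad a a0 i = a i.
Proof. by rewrite /pad valK. Qed.

Lemma pad_ge (m : nat) (A : Type) (a : 'I_m -> A) (a0 : A) (j : nat) :
  (m <= j)%N -> pad a a0 j = a0.
Proof. by move=> mj; rewrite /pad insubN // -leqNgt. Qed.

Lemma prod_pad (R : realType) (m d : nat) (a : nat -> R) (a0 : R) :
  (m <= d)%N -> (forall j, (m <= j)%N -> a j = a0) ->
  \prod_(j < d) a j = (\prod_(i < m) a i) * a0 ^+ (d - m).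
Proof.
move=> md aE; rewrite -(big_mkord xpredT a) (big_cat_nat (n := m)) //=.
rewrite big_mkord; congr (_ * _).
rewrite big_nat_cond (eq_bigr (fun=> a0)); last first.
  by move=> j /andP[/andP[mj _] _]; exact: aE.
by rewrite -big_nat_cond big_const_nat iter_mulr mulr1.
Qed.

Lemma cylinder_prod (R : realType) (T : Type) (m : nat) (f : ('I_m -> T) -> R)
    (fs : 'I_m -> T -> R) (d : nat) (x : 'I_d -> T) :
  (m <= d)%N -> (forall x, f x = \prod_(j < m) fs j (x j)) ->
  cylinder f (d := d) x = \prod_(j < d) pad fs (fun=> 1) j (x j).
Proof.
move=> md fE; rewrite /cylinder; case: {-}_ / idP => [le_md|//].
rewrite fE (bigID (fun j : 'I_d => (j < m)%N)) /= [X in _ * X]big1 ?mulr1.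
  by rewrite (big_ord_narrow le_md); apply: eq_bigr => i _; rewrite (pad_lt _ _ i).
by move=> j; rewrite -leqNgt => mj; rewrite pad_ge.
Qed.

(** Each of the m active coordinates has its own two-point measure; the d - m
    idle ones, where the factor of the cylinder is 1, share a common one. *)
Lemma rkhs_sparse_test (R : realType) (T : Type) (q : T -> T -> R) (m d : nat)
    (H : rkhs (@tensor_kernel R T q d)) (h : H) (f : ('I_m -> T) -> R)
    (fs : 'I_m -> T -> R) (b : 'I_m -> R) (x y : 'I_m -> T) (c : R) (u v : T) :
  (m <= d)%N -> (forall u v, q u v = q v u) ->
  (forall x, f x = \prod_(j < m) fs j (x j)) ->
  rkhs_fun H h = cylinder f (d := d) ->
  ((\prod_(i < m) (fs i (x i) + b i * fs i (y i))) *
     (1 + c) ^+ (d - m)) ^+ 2 <=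
  `|h| ^+ 2 * ((\prod_(i < m) pair_form q (b i) (x i) (y i)) *
     pair_form q c u v ^+ (d - m)).
Proof.
move=> md qC fE hE.
have hE' z : rkhs_fun H h z = \prod_(j < d) pad fs (fun=> 1) j (z j).
  by rewrite hE (cylinder_prod _ md fE).
have := rkhs_pair_test (g := fun j : 'I_d => pad fs (fun=> 1) j)
  (pad b c) (pad x u) (pad y v) qC hE'.
rewrite (prod_pad (a0 := 1 + c) md
  (a := fun j => pad fs (fun=> 1) j (pad x u j) +
     pad b c j * pad fs (fun=> 1) j (pad y v j))); last first.
  by move=> j mj; rewrite !(pad_ge _ _ mj) mulr1.
rewrite (prod_pad (a0 := pair_form q c u v) md
  (a := fun j => pair_form q (pad b c j) (pad x u j) (pad y v j))); last first.
  by move=> j mj; rewrite !(pad_ge _ _ mj).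
by congr ((_ * _) ^+ 2 <= _ * (_ * _)); apply: eq_bigr => i _; rewrite !pad_lt.
Qed.

Lemma ge0_diag (R : realType) (T : Type) (q : T -> T -> R) (x : T) :
  psd_kernel q -> 0 <= q x x.
Proof.
by move=> [_ /(_ 1%N (fun=> x) (fun=> 1))]; rewrite !big_ord1 !mul1r.
Qed.

Lemma pair_form_ge0 (R : realType) (T : Type) (q : T -> T -> R) (b : R)
    (x y : T) :
  psd_kernel q -> 0 <= pair_form q b x y.
Proof.
move=> [qC /(_ 2%N (fun i => if i == 0 :> nat then x else y)
  (fun i => if i == 0 :> nat then 1 else b))].
rewrite !big_ord_recl !big_ord0 /= (qC y x) /pair_form; congr (_ <= _); ring.
Qed.

Lemma pair_form0 (R : realType) (T : Type) (q : T -> T -> R) (x y : T) :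
  pair_form q 0 x y = q x x.
Proof. by rewrite /pair_form; ring. Qed.

(** Dirac masses in the active coordinates, so that only the growth in d of the
    energy of the common measure delta_u + c delta_v remains. *)
Lemma rkhs_point_test (R : realType) (T : Type) (q : T -> T -> R) (m d : nat)
    (H : rkhs (@tensor_kernel R T q d)) (h : H) (f : ('I_m -> T) -> R)
    (fs : 'I_m -> T -> R) (y : 'I_m -> T) (c : R) (u v : T) :
  (m <= d)%N -> psd_kernel q ->
  (forall x, f x = \prod_(j < m) fs j (x j)) ->
  rkhs_fun H h = cylinder f (d := d) ->
  (\prod_(i < m) fs i (y i) ^+ 2) * ((1 + c) ^+ 2) ^+ (d - m) <=
  `|h| ^+ 2 * (\prod_(i < m) q (y i) (y i)) * pair_form q c u v ^+ (d - m).
Proof.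
move=> md [qC _] fE hE.
have := rkhs_sparse_test (fun=> 0) y y c u v md qC fE hE.
rewrite exprMn -prodrXl -!exprM [(2 * _)%N]mulnC mulrA.
congr (_ * _ <= _ * _ * _); apply: eq_bigr => i _; last by rewrite pair_form0.
by rewrite mul0r addr0.
Qed.

(** The measure delta_x - delta_x' in coordinate i isolates the variation of
    the factor [fs i]; Dirac masses elsewhere. *)
Lemma rkhs_difference_test (R : realType) (T : Type) (q : T -> T -> R)
    (m d : nat) (H : rkhs (@tensor_kernel R T q d)) (h : H)
    (f : ('I_m -> T) -> R) (fs : 'I_m -> T -> R) (i : 'I_m) (y : 'I_m -> T)
    (x x' z : T) :
  (m <= d)%N -> psd_kernel q ->
  (forall x, f x = \prod_(j < m) fs j (x j)) ->
  rkhs_fun H h = cylinder f (d := d) ->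
  (fs i x - fs i x') ^+ 2 * (\prod_(j < m | j != i) fs j (y j) ^+ 2) <=
  `|h| ^+ 2 * (pair_form q (-1) x x' * (\prod_(j < m | j != i) q (y j) (y j)) *
    q z z ^+ (d - m)).
Proof.
move=> md [qC _] fE hE.
have := rkhs_sparse_test (fun j => if j == i then -1 else 0)
  (fun j => if j == i then x else y j) (fun=> x') 0 z z md qC fE hE.
rewrite addr0 expr1n mulr1 -prodrXl (bigD1 i) //= eqxx mulN1r.
rewrite [X in _ <= _ * (X * _)](bigD1 i) //= eqxx pair_form0.
congr (_ * _ <= _ * (_ * _ * _)); apply: eq_bigr => j /negPf ->.
  by rewrite mul0r addr0.
by rewrite pair_form0.
Qed.

(** * Regularity of the factors *)

(** The variation of [fs i] between x and u is at most a constant times the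
    square root of q(x, x) - 2 q(x, u) + q(u, u), which vanishes as x tends to
    u.  Evaluating the other factors at the points y j, where they are nonzero,
    allows dividing by them. *)
Lemma factor_continuous (R : realType) (T : topologicalType) (q : T -> T -> R)
    (m d : nat) (H : rkhs (@tensor_kernel R T q d)) (h : H)
    (f : ('I_m -> T) -> R) (fs : 'I_m -> T -> R) (y : 'I_m -> T) :
  (m <= d)%N -> psd_kernel q -> continuous (fun p : T * T => q p.1 p.2) ->
  (forall x, f x = \prod_(j < m) fs j (x j)) ->
  rkhs_fun H h = cylinder f (d := d) ->
  (forall i, fs i (y i) != 0) ->
  forall i, continuous (fs i).
Proof.
move=> md psd qcont fE hE y0 i u.
set K := \prod_(j < m | j != i) fs j (y j) ^+ 2.
have K0 : 0 < K by apply: prodr_gt0 => j _; rewrite exprn_even_gt0 //= y0.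
set P := `|h| ^+ 2 * ((\prod_(j < m | j != i) q (y j) (y j)) * q u u ^+ (d - m)).
have pf0 : pair_form q (-1) x u @[x --> u] --> (0 : R).
  rewrite (_ : 0 = pair_form q (-1) u u); last by rewrite /pair_form; ring.
  have c1 : q x x @[x --> u] --> q u u.
    apply: (@continuous_comp _ _ _ (fun x : T => (x, x))
      (fun p : T * T => q p.1 p.2)); last exact: qcont.
    by apply: cvg_pair; exact: cvg_id.
  have c2 : q x u @[x --> u] --> q u u.
    apply: (@continuous_comp _ _ _ (fun x : T => (x, u))
      (fun p : T * T => q p.1 p.2)); last exact: qcont.
    by apply: cvg_pair; [exact: cvg_id|exact: cvg_cst].
  rewrite /pair_form; apply: cvgD; last exact: cvg_cst.
  by apply: cvgD => //; apply: cvgMr.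
have lim0 : P * pair_form q (-1) x u @[x --> u] --> (0 : R).
  by rewrite -(mulr0 P); apply: cvgMr.
apply/cvgrPdist_lt => e e0.
have Ke : 0 < e ^+ 2 * K by rewrite mulr_gt0 // exprn_gt0.
move/cvgrPdist_lt/(_ _ Ke): lim0; apply: filterS => x.
rewrite sub0r normrN => /(le_lt_trans (ler_norm _)) lt.
have := rkhs_difference_test i y x u u md psd fE hE.
rewrite -/K => le.
have : (fs i x - fs i u) ^+ 2 * K < e ^+ 2 * K.
  by apply: le_lt_trans le _; apply: le_lt_trans lt; rewrite le_eqVlt /P;
    apply/orP; left; apply/eqP; ring.
rewrite ltr_pM2r // -[X in X < _]real_normK ?num_real // distrC.
by rewrite ltr_pXn2r // nnegrE // ltW.
Qed.

(** * Points where the kernel is small on the diagonal *)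

(** The integral of a nonnegative function is a supremum over the simple
    functions below it, hence monotone without measurability.  This spares a
    proof that the diagonal of the kernel, extended by 0, is measurable. *)
Lemma ge0_le_integral_any (d : measure_display) (T : measurableType d)
    (R : realType) (mu : {measure set T -> \bar R}) (D : set T)
    (f g : T -> \bar R) :
  (forall x, D x -> (0 <= f x)%E) -> (forall x, D x -> (f x <= g x)%E) ->
  (\int[mu]_(x in D) f x <= \int[mu]_(x in D) g x)%E.
Proof.
move=> f0 fg.
have g0 x : D x -> (0 <= g x)%E by move=> Dx; exact: le_trans (f0 _ Dx) (fg _ Dx).
rewrite !ge0_integralE //; apply: ereal_sup_le => _ [h hf <-]; exists h => //=.
move=> x; apply: le_trans (hf x) _; rewrite /patch.
by case: ifPn => // /set_mem; exact: fg.
Qed.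

(** Otherwise g would lie above the simple function a + b 1_U on X, of integral
    a + b mu(U) > 1.  The lower bound a matters: for g = q(x, x) and a close to
    1, it bounds g - a on U by a multiple of 1 - a. *)
Lemma markov_point (R : realType) (X : set R)
    (mu : probability (measurableTypeR R) R) (U : set R) (g : X -> R)
    (a b : R) :
  compact X -> mu X = 1%E -> open U -> 0 <= a -> 0 < b ->
  (forall x, a <= g x) ->
  (\int[mu]_(x in X) ('valL_0 g x)%:E <= 1)%E ->
  1 < a + b * fine (mu (U `&` X)) ->
  exists2 x : X, U (set_val x) & g x < a + b.
Proof.
move=> cX muX oU a0 b0 ag ig1 ab1; apply: contrapT => nx.
have mX : measurable X := compact_measurable cX.
have mU : measurable U by exact: open_measurable.
have mUX : measurable (U `&` X) by exact: measurableI.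
have mufin : mu (U `&` X) \is a fin_num by exact: fin_num_measure.
have gE (x : X) : 'valL_0 g (set_val x) = g x.
  by rewrite -[in RHS](valLK 0 g).
have ge x : X x -> a + b * \1_(U `&` X) x <= 'valL_0 g x.
  move=> Xx; pose y : X := exist _ x (mem_set Xx).
  rewrite [x](_ : x = set_val y) // gE indicE.
  have [xU|xU] := pselect ((U `&` X) (set_val y)).
    rewrite mem_set //= mulr1 leNgt; apply/negP => gab; apply: nx.
    by exists y => //; case: xU.
  by rewrite memNset //= mulr0 addr0 ag.
have : (\int[mu]_(x in X) (a%:E + (b * \1_(U `&` X) x)%:E) <= 1)%E.
  apply: le_trans ig1; apply: ge0_le_integral_any => x Xx.
    by rewrite -EFinD lee_fin addr_ge0 // mulr_ge0 // ltW.
  by rewrite -EFinD lee_fin ge.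
rewrite ge0_integralD //=; last 2 first.
- by move=> x _; rewrite lee_fin mulr_ge0 // ltW.
- by apply/measurable_EFinP; apply: measurable_funM.
rewrite integral_cst //= muX mule1.
have bU : b < 0 -> U `&` X = set0 by rewrite ltNge ltW.
rewrite (integralZl_indic (m := mu) mX (fun=> U `&` X) b bU mUX) /=.
rewrite integral_indic // -setIA setIid.
rewrite -[X in (_ + _ * X)%E](fineK mufin) -EFinM -EFinD lee_fin.
by rewrite leNgt ab1.
Qed.

(** The constant p depends on V alone and serves all the kernels q_d. *)
Lemma full_support_nbhs (R : realType) (X : set R)
    (mu : probability (measurableTypeR R) R) (u : X) (V : set X) :
  compact X -> full_support X mu -> nbhs u V ->
  exists2 p : R, 0 < p & forall (g : X -> R) (a b : R), 0 <= a -> 0 < b ->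
    (forall x, a <= g x) ->
    (\int[mu]_(x in X) ('valL_0 g x)%:E <= 1)%E ->
    1 < a + b * p -> exists2 x, V x & g x < a + b.
Proof.
move=> cX [muX supp] [_ [[U oU <-] Uu UV]].
have mufin : mu (U `&` X) \is a fin_num.
  apply: fin_num_measure; apply: measurableI; last exact: compact_measurable.
  exact: open_measurable.
have mu0 : (0 < mu (U `&` X))%E.
  by apply: supp => //; exists (set_val u); split => //; exact: set_valP.
exists (fine (mu (U `&` X))); first by apply: fine_gt0; rewrite mu0 ltey_eq mufin.
move=> g a b a0 b0 ag ig1 ab1.
have [x Ux gx] := markov_point cX muX oU a0 b0 ag ig1 ab1.
by exists x => //; exact: UV.
Qed.

(** * Powers with large exponents *)

(** The points z with q(z, z) < 1 + eta stand in for a point with q(z, z) <= 1;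
    the eta adapted to the exponent keeps the (d - m)-th power bounded. *)
Lemma expr_near1_le2 (R : realType) (n : nat) :
  exists2 eta : R, 0 < eta & (1 + eta) ^+ n <= 2.
Proof.
exists (4 ^+ n)^-1; first by rewrite invr_gt0.
set e := (4 ^+ n)^-1.
have e0 : 0 < e by rewrite invr_gt0.
have e1 : e <= 1 by rewrite invf_le1 // exprn_ege1 // ler1n.
(* The ratio 4 makes the induction work: e + 2 * 4 ^+ k * e <= 4 ^+ k.+1 * e. *)
have step k : (1 + e) ^+ k <= 1 + 4 ^+ k * e.
  elim: k => [|k IH]; first by rewrite !expr0 mul1r; lra.
  rewrite !exprS.
  apply: (@le_trans _ _ ((1 + e) * (1 + 4 ^+ k * e))).
    by rewrite ler_pM2l //; lra.
  have : 1 <= (4 : R) ^+ k by rewrite exprn_ege1 // ler1n.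
  set c := 4 ^+ k => c1.
  have ec : e <= c * e by rewrite ler_peMl // ltW.
  have ece : c * e * e <= c * e by rewrite ler_piMr // (le_trans (ltW e0) ec).
  by rewrite (_ : _ * _ = 1 + c * e + e + c * e * e); [lra | ring].
by apply: le_trans (step n) _; rewrite /e mulfV ?gt_eqF //; lra.
Qed.

(** Taking n-th roots: if B > 0, the hypothesis on r says that
    r < (K / B)^(1 / n), which for r < 1 is true once n is large. *)
Lemma expr_bound_ler (R : realType) (r K B s t : R) (n : nat) :
  0 <= r -> 0 <= B -> r ^+ n * B < K -> 0 <= s -> 0 <= t ->
  K * s ^+ n <= B * t ^+ n -> r * s <= t.
Proof.
move=> r0 B0 rK s0 t0 KB; rewrite leNgt; apply/negP => ts.
have sp : 0 < s.
  rewrite lt_neqAle s0 andbT; apply/eqP => se.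
  by move: ts; rewrite -se mulr0 ltNge t0.
move: KB; apply/negP; rewrite -ltNge.
apply: (@le_lt_trans _ _ (r ^+ n * B * s ^+ n)).
  rewrite mulrAC [leRHS]mulrC -exprMn ler_wpM2l // lerXn2r //.
  - by rewrite nnegrE mulr_ge0.
  - exact: ltW.
by rewrite ltr_pM2r // exprn_gt0.
Qed.

(** * Divergence of the norms *)

Lemma nonconstant_product (R : realType) (T : Type) (m : nat)
    (f : ('I_m -> T) -> R) (fs : 'I_m -> T -> R) :
  (forall x, f x = \prod_(j < m) fs j (x j)) -> ~ (exists c, forall x, f x = c) ->
  exists y i u, (forall i, fs i (y i) != 0) /\ fs i u != fs i (y i).
Proof.
move=> fE nc.
have [y fy] : exists y, f y != 0.
  apply: contrapT => ny; apply: nc; exists 0 => x.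
  by apply/eqP/negPn/negP => fx; apply: ny; exists x.
have y0 i : fs i (y i) != 0.
  by move: fy; rewrite fE => /prodf_neq0; apply.
apply: contrapT => nx; apply: nc; exists (f y) => x; rewrite !fE.
apply: eq_bigr => i _; apply/eqP/negPn/negP => fi; apply: nx.
by exists y, i, (x i).
Qed.

Lemma rkhs_norm_ge (R : realType) (T : Type) (k : T -> T -> R) (H : rkhs k)
    (f : T -> R) (A : R) :
  (forall h : H, rkhs_fun H h = f -> A <= `|h|) -> (A%:E <= rkhs_norm H f)%E.
Proof.
move=> Ah; rewrite /rkhs_norm; case: pselect => [fH|_]; last exact: leey.
by rewrite lee_fin; apply: Ah; exact: (projT2 (cid fH)).
Qed.

(** Suppose that |h| < A for some large d.  Points near the y i where q_d is
    bounded give, through [rkhs_point_test], that q_d - (1 - eps) is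
    nonnegative on the measures delta_v + c delta_w.  Its diagonal has integral
    at most eps, so its energy on delta_v - delta_w is at most eps M for some v
    near u and w near [y i0]; [rkhs_difference_test] then bounds the fixed
    quantity delta^2 K' by eps E, against the choice of eps. *)
Lemma rkhs_norm_eventually_ge (R : realType) (X : set R) (q : nat -> X -> X -> R)
    (H : forall d : nat, rkhs (@tensor_kernel R X (q d) d))
    (mu : probability (measurableTypeR R) R)
    (m : nat) (f : ('I_m -> X) -> R) (fs : 'I_m -> X -> R)
    (y : 'I_m -> X) (i0 : 'I_m) (u : X) (A : R) :
  compact X -> (forall d, psd_kernel (q d)) -> full_support X mu ->
  (forall d,
     (\int[mu]_(x in X) ('valL_0 (fun y : X => q d y y) x)%:E <= 1)%E) ->
  (forall x, f x = \prod_(j < m) fs j (x j)) ->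
  (forall i, continuous (fs i)) -> (forall i, fs i (y i) != 0) ->
  fs i0 u != fs i0 (y i0) -> 0 < A ->
  exists N, forall d, (N <= d)%N ->
    forall h : H d, rkhs_fun (H d) h = cylinder f (d := d) -> A <= `|h|.
Proof.
move=> cX psd supp iq fE fc fy0 fuy A0.
have [muX _] := supp.
have nbhs_pt (w : X) V := @full_support_nbhs R X mu w V cX supp.
(* Half of |fs i (y i)|, so that it remains a lower bound near y i. *)
pose kappa i := `|fs i (y i)| / 2.
have kappa0 i : 0 < kappa i by rewrite divr_gt0 // normr_gt0.
have nearV i : nbhs (y i) [set x | kappa i < `|fs i x|].
  have /cvgrPdist_lt/(_ _ (kappa0 i)) := fc i (y i); apply: filterS => x /= xy.
  have := ler_normD (fs i (y i) - fs i x) (fs i x); rewrite subrK => le.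
  by move: le xy; rewrite /kappa; lra.
(* Markov with a = 0 and b = 2 / p i, so that a + b * p i = 2 > 1. *)
have /choice[p pP] : forall i, exists p : R, 0 < p /\
    forall d, exists2 x, kappa i < `|fs i x| & q d x x < 2 / p.
  move=> i; have [p p0 pP] := nbhs_pt _ _ (nearV i); exists p; split => // d.
  have [//|||||x] := pP (fun x => q d x x) 0 (2 / p).
  - by rewrite divr_gt0.
  - by move=> x; exact: ge0_diag.
  - exact: iq.
  - by rewrite add0r divfK ?gt_eqF //; lra.
  by rewrite add0r => Vx qx; exists x.
have p0 i : 0 < p i by case: (pP i).
(* A third of the gap: values within delta of the two ends stay delta apart. *)
pose delta := `|fs i0 u - fs i0 (y i0)| / 3.
have delta0 : 0 < delta by rewrite divr_gt0 // normr_gt0 subr_eq0.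
have near_fs (w : X) : nbhs w [set x | `|fs i0 w - fs i0 x| < delta].
  by have /cvgrPdist_lt/(_ _ delta0) := fc i0 w.
have [pu pu0 puP] := nbhs_pt _ _ (near_fs u).
have [pv pv0 pvP] := nbhs_pt _ _ (near_fs (y i0)).
pose K := \prod_(i < m) kappa i ^+ 2.
pose K' := \prod_(i < m | i != i0) kappa i ^+ 2.
pose P := \prod_(i < m) (2 / p i).
pose P' := \prod_(i < m | i != i0) (2 / p i).
have K0 : 0 < K by apply: prodr_gt0 => i _; rewrite exprn_gt0.
have K'0 : 0 < K' by apply: prodr_gt0 => i _; rewrite exprn_gt0.
have P0 : 0 < P by apply: prodr_gt0 => i _; rewrite divr_gt0.
have P'0 : 0 < P' by apply: prodr_gt0 => i _; rewrite divr_gt0.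
pose M := 4 * (pu^-1 + pv^-1).
have M0 : 0 < M by rewrite mulr_gt0 // addr_gt0 // invr_gt0.
pose E := A ^+ 2 * (M * P' * 2).
have E0 : 0 < E by rewrite mulr_gt0 ?exprn_gt0 // mulr_gt0 // mulr_gt0.
(* Below delta ^+ 2 * K' / E, for the final contradiction, and below 1. *)
pose eps := Num.min (1 / 2) (delta ^+ 2 * K' / E / 2).
have t0 : 0 < delta ^+ 2 * K' / E / 2.
  by rewrite divr_gt0 // divr_gt0 // mulr_gt0 // exprn_gt0.
have eps0 : 0 < eps by rewrite lt_min t0 andbT; lra.
have eps1 : eps <= 1 / 2 by rewrite ge_min lexx.
have epsE : eps * E < delta ^+ 2 * K'.
  rewrite -ltr_pdivlMr //; have : eps <= delta ^+ 2 * K' / E / 2.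
    by rewrite ge_min lexx orbT.
  by move: t0; set t := _ / E; lra.
have [N _ NP] : \forall n \near \oo, (1 - eps) ^+ n * (A ^+ 2 * P) < K.
  have e1 : `|1 - eps| < 1 by rewrite ltr_norml; apply/andP; split; lra.
  have /cvgrPdist_lt/(_ _ K0) := cvg_geometric (A ^+ 2 * P) e1.
  apply: filterS => n; rewrite sub0r normrN => /(le_lt_trans (ler_norm _)).
  by rewrite /geometric /= mulrC.
exists (N + m)%N => d Nd h hE; rewrite leNgt; apply/negP => hA.
have md : (m <= d)%N by apply: leq_trans Nd; exact: leq_addl.
have h2 : `|h| ^+ 2 <= A ^+ 2.
  by rewrite lerXn2r // ?nnegrE ?normr_ge0 ?ltW.
(* The points x i depend on d, their bounds do not. *)
have /choice[x xP] : forall i, exists x,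
    kappa i < `|fs i x| /\ q d x x < 2 / p i.
  by move=> i; have [_ /(_ d)[x]] := pP i; exists x.
have fx i : kappa i ^+ 2 <= fs i (x i) ^+ 2.
  rewrite -[leRHS]real_normK ?num_real // lerXn2r ?nnegrE ?normr_ge0 //.
    exact: ltW.
  by apply: ltW; case: (xP i).
have qx i : 0 <= q d (x i) (x i) <= 2 / p i.
  by rewrite ge0_diag //= ltW //; case: (xP i).
have form_ge c v w : (1 - eps) * (1 + c) ^+ 2 <= pair_form (q d) c v w.
  apply: (expr_bound_ler _ _ (NP (d - m)%N _)); rewrite ?sqr_ge0 //.
  - by lra.
  - by rewrite mulr_ge0 ?sqr_ge0 // ltW.
  - by rewrite /= leq_subRL // addnC.
  - exact: pair_form_ge0.
  have test := rkhs_point_test x c v w md (psd d) fE hE.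
  apply: le_trans (le_trans _ test) _.
    apply: ler_wpM2r; first by rewrite exprn_ge0 ?sqr_ge0.
    by apply: ler_prod => i _; rewrite sqr_ge0 fx.
  apply: ler_wpM2r; first by rewrite exprn_ge0 ?pair_form_ge0.
  apply: ler_pM; rewrite ?sqr_ge0 //.
    by apply: prodr_ge0 => i _; exact: ge0_diag.
  by apply: ler_prod => i _; exact: qx.
have diag_ge v : 1 - eps <= q d v v.
  by have := form_ge 0 v v; rewrite addr0 expr1n mulr1 pair_form0.
(* Markov with a = 1 - eps and b = 2 eps / r, so that a + b r = 1 + eps > 1. *)
have eps_p r : 0 < r -> 0 < 2 * eps / r by move=> r0; rewrite divr_gt0 ?mulr_gt0.
have one_lt r : 0 < r -> 1 < 1 - eps + 2 * eps / r * r.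
  by move=> r0; rewrite divfK ?gt_eqF //; lra.
have r0 : 0 <= 1 - eps by lra.
have [v vu qv] := puP (fun x => q d x x) (1 - eps) (2 * eps / pu) r0
  (eps_p _ pu0) diag_ge (iq d) (one_lt _ pu0).
have [w wy qw] := pvP (fun x => q d x x) (1 - eps) (2 * eps / pv) r0
  (eps_p _ pv0) diag_ge (iq d) (one_lt _ pv0).
(* Parallelogram law: the energies of delta_v + delta_w and delta_v - delta_w
   add up to 2 (q(v, v) + q(w, w)), and the first is at least 4 (1 - eps). *)
have form_le : pair_form (q d) (-1) v w <= eps * M.
  have := form_ge 1 v w; rewrite /pair_form /M.
  move: qv qw; rewrite /=; set a := pu^-1; set b := pv^-1; nra.
have [eta eta0 eta2] := expr_near1_le2 R (d - m).
have [//|||||z _ qz] := markov_point (g := fun x => q d x x)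
  (a := 0) (b := 1 + eta) cX muX (@openT R).
- by lra.
- by move=> ?; exact: ge0_diag.
- exact: iq.
- by rewrite setTI muX /= add0r mulr1; lra.
rewrite add0r in qz.
have test := rkhs_difference_test i0 x v w z md (psd d) fE hE.
have : delta ^+ 2 * K' <= eps * E.
  apply: le_trans (le_trans _ test) _.
    apply: ler_pM; rewrite ?sqr_ge0 //; [exact: ltW| |].
      rewrite -[leRHS]real_normK ?num_real // lerXn2r ?nnegrE ?normr_ge0 //.
        exact: ltW.
      move: vu wy; rewrite /delta /=.
      have := ler_normD (fs i0 u - fs i0 v) (fs i0 v - fs i0 w).
      have := ler_normD (fs i0 u - fs i0 w) (fs i0 w - fs i0 (y i0)).
      by rewrite !subrKA (distrC (fs i0 w) (fs i0 (y i0))); lra.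
    by apply: ler_prod => i _; rewrite sqr_ge0 fx.
  have prod_ge0 : 0 <= \prod_(j < m | j != i0) q d (x j) (x j).
    by apply: prodr_ge0 => i _; exact: ge0_diag.
  rewrite /E [leRHS](_ : _ = A ^+ 2 * (eps * M * P' * 2)); last by ring.
  apply: ler_pM => //; rewrite ?sqr_ge0 //.
    by rewrite !mulr_ge0 ?pair_form_ge0 ?exprn_ge0 ?ge0_diag.
  apply: ler_pM => //.
  - by rewrite mulr_ge0 ?pair_form_ge0.
  - by rewrite exprn_ge0 // ge0_diag.
  - apply: ler_pM => //; first exact: pair_form_ge0.
    by apply: ler_prod => i _; exact: qx.
  apply: le_trans eta2; rewrite lerXn2r ?nnegrE ?ge0_diag //; last exact: ltW.
  by lra.
by rewrite leNgt epsE.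
Qed.

Theorem lemmaB1 (R : realType) (X : set R) (q : nat -> X -> X -> R)
    (H : forall d : nat, rkhs (@tensor_kernel R X (q d) d))
    (m : nat) (f : ('I_m -> X) -> R) (fs : 'I_m -> X -> R) :
  compact X ->
  (forall d, continuous (fun p : X * X => q d p.1 p.2)) ->
  (forall d, psd_kernel (q d)) ->
  (exists mu : probability (measurableTypeR R) R,
     full_support X mu /\
     forall d,
       (\int[mu]_(x in X) ('valL_0 (fun y : X => q d y y) x)%:E <= 1)%E) ->
  (forall x, f x = \prod_(j < m) fs j (x j)) ->
  ~ (exists c : R, forall x, f x = c) ->
  (fun d => rkhs_norm (H d) (cylinder f (d := d))) @ \oo --> +oo%E.
Proof.
move=> cX qc psd [mu [supp iq]] fE nc.
have [y [i [u [y0 fu]]]] := nonconstant_product fE nc.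
apply/cvgeyPge => A.
(* Either f is in one of the spaces, and its factors are continuous, or its
   norms are infinite from m on. *)
have [[d0 [md0 [h0 h0E]]]|nH] := pselect (exists d0, (m <= d0)%N /\
    exists h0 : H d0, rkhs_fun (H d0) h0 = cylinder f (d := d0)).
  have fc := factor_continuous md0 (psd d0) (qc d0) fE h0E y0.
  have A'0 : 0 < Num.max A 1 by rewrite lt_max ltr01 orbT.
  have [N NP] := rkhs_norm_eventually_ge H cX psd supp iq fE fc y0 fu A'0.
  exists N => // d /= Nd; apply: rkhs_norm_ge => h hE.
  by apply: le_trans (NP d Nd h hE); rewrite le_max lexx.
exists m => // d /= md; apply: rkhs_norm_ge => h hE; exfalso; apply: nH.
by exists d; split => //; exists h.
Qed.
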